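(* Let $\mathbb{F}\in\{\mathbb{R},\mathbb{C}\}$, let $n=p+q$ be an even positive integer, let $V$ be an $r$-dimensional Euclidean space, let $\Omega\subset V$ be an open domain, and let $k\ge 0$ be an integer. Let $h^a=h^a(x)$ and $g^a=g^a(x)$, $a=1,\dots,n$, be functions $\Omega\to\mathcal{C}\ell^{\mathbb{F}}(p,q)$ of class $C^k(\Omega)$ such that for all $a,b=1,\dots,n$ and all $x\in\Omega$ $$h^a(x)h^b(x)+h^b(x)h^a(x)=2\eta^{ab}e,\qquad g^a(x)g^b(x)+g^b(x)g^a(x)=2\eta^{ab}e .$$ Then for any point $x_0\in\Omega$ there exist $\varepsilon>0$ with $O_\varepsilon(x_0)\subset\Omega$ and a function $T=T(x):O_\varepsilon(x_0)\to\mathcal{C}\ell^{\mathbb{F}}(p,q)$ such that: 1. $T$ is of class $C^k(O_\varepsilon(x_0))$; 2. $T(x)$ is an invertible element of $\mathcal{C}\ell^{\mathbb{F}}(p,q)$ for every $x\in O_\varepsilon(x_0)$; 3. $g^a(x)=T^{-1}(x)h^a(x)T(x)$ for $a=1,\dots,n$ and all $x\in O_\varepsilon(x_0)$; 4. the function $T$ (with properties 1–3 on $O_\varepsilon(x_0)$) is defined up to multiplication by an $\mathbb{F}$-valued function of class $C^k(O_\varepsilon(x_0))$ that is nonzero at every point of $O_\varepsilon(x_0)$.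
   Context: $\mathcal{C}\ell^{\mathbb{R}}(p,q)$, $n=p+q$, is the real Clifford algebra with identity $e$ and generators $e^1,\dots,e^n$ satisfying $e^ae^b+e^be^a=2\eta^{ab}e$, where $\eta=\|\eta^{ab}\|$ is the diagonal matrix with $p$ entries $1$ followed by $q$ entries $-1$. It has dimension $2^n$, with basis $e^{a_1\ldots a_k}:=e^{a_1}\cdots e^{a_k}$, $a_1<\dots<a_k$, $0\le k\le n$ (the empty product being $e$). $\mathcal{C}\ell^{\mathbb{C}}(p,q)=\mathbb{C}\otimes\mathcal{C}\ell^{\mathbb{R}}(p,q)$ is its complexification. A function into $\mathcal{C}\ell^{\mathbb{F}}(p,q)$ is of class $C^k$ if all its $\mathbb{F}$-valued coordinate functions with respect to this fixed basis have continuous partial derivatives up to order $k$ ($C^0$ means continuous). $O_\varepsilon(x_0)=\{x\in V:\|x-x_0\|<\varepsilon\}$. *)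

(* Defs.v *)
From HB Require Import structures.
From mathcomp Require Import all_boot all_order all_algebra all_field.

Set Implicit Arguments.
Unset Strict Implicit.
Unset Printing Implicit Defensive.
Import Order.TTheory GRing.Theory Num.Theory.

Local Open Scope ring_scope.

Definition cl_metric (F : fieldType) (p q : nat) : 'M[F]_(p + q) :=
  diag_mx (\row_a (if (a < p)%N then 1 else -1)).

Section SymmetricDifference.
Variable T : finType.
Implicit Types A B C : {set T}.

Definition symdiff A B : {set T} := (A :\: B) :|: (B :\: A).

Lemma in_symdiff A B x : (x \in symdiff A B) = (x \in A) (+) (x \in B).
Proof. by rewrite !inE; case: (x \in A); case: (x \in B). Qed.

Lemma symdiffA : associative symdiff.
Proof. by move=> A B C; apply/setP=> x; rewrite !in_symdiff addbA. Qed.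

Lemma symdiffC : commutative symdiff.
Proof. by move=> A B; apply/setP=> x; rewrite !in_symdiff addbC. Qed.

Lemma symdiffK A : cancel (symdiff A) (symdiff A).
Proof. by move=> B; apply/setP=> x; rewrite !in_symdiff addKb. Qed.

Lemma symdiff0 A : symdiff A set0 = A.
Proof. by rewrite /symdiff setD0 set0D setU0. Qed.

Lemma symdiff_id A : symdiff A A = set0.
Proof. by rewrite /symdiff setDv setU0. Qed.

End SymmetricDifference.

(* The Clifford algebra over F, given by its coordinates in the basis
   e^A := e^{a_1} ... e^{a_k} for A = {a_1 < ... < a_k}. The generators are
   indexed from 0. For F = R[i] this is the complexification of the algebra
   over R, see cl_map below. *)
Definition clifford (F : fieldType) (p q : nat) : Type :=
  {ffun {set 'I_(p + q)} -> F^o}.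

HB.instance Definition _ (F : fieldType) (p q : nat) :=
  Vector.copy (clifford F p q) {ffun {set 'I_(p + q)} -> F^o}.

Definition cl_coord (F : fieldType) (p q : nat) (x : clifford F p q)
  (A : {set 'I_(p + q)}) : F := (x : {ffun {set 'I_(p + q)} -> F^o}) A.

Section CliffordAlgebra.
Variables (F : fieldType) (p q : nat).
Local Notation I := 'I_(p + q).
Local Notation Cl := (clifford F p q).
Implicit Types (A B C : {set I}) (x y z : Cl).

Definition cl_basis A : Cl := [ffun B => (B == A)%:R : F^o].

(* e^A e^B = cl_sign A B *: e^(A symdiff B): moving each e^b leftwards past
   the e^a with a > b costs a factor -1, and (e^a)^2 = eta^{aa} e. *)
Definition cl_swap (a b : I) : F :=
  if (b < a)%N then -1 else if a == b then cl_metric F p q a a else 1.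

Definition cl_sign A B : F := \prod_(a in A) \prod_(b in B) cl_swap a b.

Definition cl_mul x y : Cl :=
  [ffun C => \sum_A cl_sign A (symdiff A C)
               * (cl_coord x A * cl_coord y (symdiff A C)) : F^o].

Lemma cl_metric_sqr a : cl_metric F p q a a * cl_metric F p q a a = 1.
Proof.
by rewrite !mxE eqxx mulr1n; case: ifP => _; rewrite ?mulr1 ?mulrNN ?mulr1.
Qed.

Lemma cl_swap_sqr a b : cl_swap a b * cl_swap a b = 1.
Proof.
rewrite /cl_swap; case: ifP => _; first by rewrite mulrNN mulr1.
by case: ifP => _; rewrite ?mulr1 ?cl_metric_sqr.
Qed.

Lemma prod_symdiff (f : I -> F) A B : (forall a, f a * f a = 1) ->
  \prod_(a in symdiff A B) f a = (\prod_(a in A) f a) * \prod_(a in B) f a.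
Proof.
move=> f2; rewrite big_mkcond [X in X * _]big_mkcond [X in _ * X]big_mkcond /=.
rewrite -big_split; apply: eq_bigr => a _; rewrite in_symdiff.
by case: (a \in A); case: (a \in B); rewrite /= ?mulr1 ?mul1r ?f2.
Qed.

Lemma cl_signDl A B C : cl_sign (symdiff A B) C = cl_sign A C * cl_sign B C.
Proof.
rewrite /cl_sign prod_symdiff // => a; rewrite -big_split big1 // => b _.
exact: cl_swap_sqr.
Qed.

Lemma cl_signDr A B C : cl_sign A (symdiff B C) = cl_sign A B * cl_sign A C.
Proof.
rewrite /cl_sign -big_split; apply: eq_bigr => a _; apply: prod_symdiff => b.
exact: cl_swap_sqr.
Qed.

Lemma cl_sign0l A : cl_sign set0 A = 1.
Proof. by rewrite /cl_sign big_set0. Qed.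

Lemma cl_sign0r A : cl_sign A set0 = 1.
Proof. by rewrite /cl_sign big1 // => a _; rewrite big_set0. Qed.

Lemma cl_coordP x y : cl_coord x =1 cl_coord y -> x = y.
Proof. by move=> xy; apply/ffunP. Qed.

Lemma cl_coord_basis A B : cl_coord (cl_basis A) B = (B == A)%:R.
Proof. by rewrite /cl_coord ffunE. Qed.

Lemma cl_coordM x y C : cl_coord (cl_mul x y) C =
  \sum_A cl_sign A (symdiff A C) * (cl_coord x A * cl_coord y (symdiff A C)).
Proof. by rewrite /cl_coord ffunE. Qed.

Lemma cl_coordD x y A : cl_coord (x + y) A = cl_coord x A + cl_coord y A.
Proof. by rewrite /cl_coord ffunE. Qed.

Lemma cl_coordZ c x A : cl_coord (c *: x) A = c * cl_coord x A.
Proof. by rewrite /cl_coord ffunE. Qed.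

Lemma cl_coord0 A : cl_coord (0 : Cl) A = 0.
Proof. by rewrite /cl_coord ffunE. Qed.

Lemma cl_mulA : associative cl_mul.
Proof.
move=> x y z; apply: cl_coordP => D; rewrite !cl_coordM.
under eq_bigr => A _ do rewrite cl_coordM !mulr_sumr.
under [RHS]eq_bigr => C _ do rewrite cl_coordM mulr_suml mulr_sumr.
rewrite [RHS]exchange_big; apply: eq_bigr => A _ /=.
rewrite (reindex_inj (can_inj (symdiffK A))) /=; apply: eq_bigr => C _.
have -> : symdiff (symdiff A C) (symdiff A D) = symdiff C D.
  by rewrite [symdiff A C]symdiffC -symdiffA symdiffK.
have -> : cl_sign C (symdiff C D) =
    cl_sign A (symdiff C D) * cl_sign (symdiff A C) (symdiff C D).
  by rewrite -cl_signDl symdiffK.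
have -> : cl_sign A (symdiff A D) =
    cl_sign A (symdiff A C) * cl_sign A (symdiff C D).
  by rewrite -cl_signDr -symdiffA symdiffK.
rewrite -!mulrA mulrCA; congr (_ * _).
rewrite [RHS]mulrCA; congr (_ * _).
by rewrite mulrCA.
Qed.

Lemma cl_mul1 : left_id (cl_basis set0) cl_mul.
Proof.
move=> x; apply: cl_coordP => C; rewrite cl_coordM (bigD1 set0) //= big1.
  by rewrite symdiffC symdiff0 cl_sign0l cl_coord_basis eqxx !mul1r addr0.
by move=> A A0; rewrite cl_coord_basis (negPf A0) mul0r mulr0.
Qed.

Lemma cl_mulr1 : right_id (cl_basis set0) cl_mul.
Proof.
move=> x; apply: cl_coordP => C; rewrite cl_coordM (bigD1 C) //= big1.
  by rewrite symdiff_id cl_sign0r cl_coord_basis eqxx mul1r mulr1 addr0.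
move=> A AC; rewrite cl_coord_basis; case: eqP => [e|]; last by rewrite !mulr0.
by rewrite -(symdiffK A C) e symdiff0 eqxx in AC.
Qed.

Lemma cl_mulDl : left_distributive cl_mul +%R.
Proof.
move=> x y z; apply: cl_coordP => C; rewrite cl_coordD !cl_coordM -big_split.
by apply: eq_bigr => A _; rewrite cl_coordD mulrDl mulrDr.
Qed.

Lemma cl_mulDr : right_distributive cl_mul +%R.
Proof.
move=> x y z; apply: cl_coordP => C; rewrite cl_coordD !cl_coordM -big_split.
by apply: eq_bigr => A _; rewrite cl_coordD mulrDr mulrDr.
Qed.

Lemma cl_one_neq0 : cl_basis set0 != 0.
Proof.
apply/eqP => /(congr1 (fun x : Cl => cl_coord x set0)) /eqP.
by rewrite cl_coord_basis cl_coord0 eqxx oner_eq0.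
Qed.

Lemma cl_scaleAl c x y : c *: cl_mul x y = cl_mul (c *: x) y.
Proof.
apply: cl_coordP => C; rewrite cl_coordZ !cl_coordM mulr_sumr.
by apply: eq_bigr => A _; rewrite cl_coordZ mulrCA !mulrA.
Qed.

Lemma cl_scaleAr c x y : c *: cl_mul x y = cl_mul x (c *: y).
Proof.
apply: cl_coordP => C; rewrite cl_coordZ !cl_coordM mulr_sumr.
by apply: eq_bigr => A _; rewrite cl_coordZ mulrCA [c * (_ * _)]mulrCA.
Qed.

End CliffordAlgebra.

HB.instance Definition _ (F : fieldType) (p q : nat) :=
  GRing.Zmodule_isNzRing.Build (clifford F p q) (@cl_mulA F p q)
    (@cl_mul1 F p q) (@cl_mulr1 F p q) (@cl_mulDl F p q) (@cl_mulDr F p q)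
    (@cl_one_neq0 F p q).

HB.instance Definition _ (F : fieldType) (p q : nat) :=
  GRing.Lmodule_isLalgebra.Build F (clifford F p q) (@cl_scaleAl F p q).

HB.instance Definition _ (F : fieldType) (p q : nat) :=
  GRing.Lalgebra_isAlgebra.Build F (clifford F p q) (@cl_scaleAr F p q).

HB.instance Definition _ (F : fieldType) (p q : nat) :=
  Algebra_isFalgebra.Build F (clifford F p q).

Definition cl_gen (F : fieldType) (p q : nat) (a : 'I_(p + q)) :
  clifford F p q := cl_basis F [set a].

Section CliffordTheory.
Variables (F : fieldType) (p q : nat).
Local Notation I := 'I_(p + q).
Local Notation Cl := (clifford F p q).

Lemma cl_basisM (A B : {set I}) :
  cl_basis F A * cl_basis F B = cl_sign F A B *: cl_basis F (symdiff A B).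
Proof.
apply: cl_coordP => C; rewrite cl_coordM cl_coordZ (bigD1 A) //= big1.
  rewrite !cl_coord_basis eqxx mul1r addr0.
  have -> : (C == symdiff A B) = (symdiff A C == B).
    by apply/eqP/eqP => [->|<-]; rewrite symdiffK.
  by case: eqP => [->|_]; rewrite ?mulr0.
by move=> D DA; rewrite cl_coord_basis (negPf DA) mul0r mulr0.
Qed.

Theorem cl_genP (a b : I) :
  cl_gen F a * cl_gen F b + cl_gen F b * cl_gen F a
    = (cl_metric F p q a b *+ 2)%:A.
Proof.
rewrite !cl_basisM [symdiff [set b] _]symdiffC -scalerDl.
rewrite /cl_sign !big_set1 /cl_swap [b == a]eq_sym.
have [->|ab] := eqVneq a b; first by rewrite ltnn symdiff_id -mulr2n.
rewrite [cl_metric F p q a b]mxE (negPf ab) mulr0n mul0rn !scale0r.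
by case: ltngtP => [||e]; rewrite ?addNr ?subrr ?scale0r //;
  case/eqP: ab; apply: val_inj.
Qed.

(* enum A lists A in increasing order. *)
Theorem cl_basisE (A : {set I}) :
  cl_basis F A = \prod_(a <- enum A) cl_gen F a.
Proof.
have srt : sorted (fun a b : I => (a < b)%N) (enum A).
  rewrite {1}/enum_mem; apply: sorted_filter.
    by move=> a b c; exact: ltn_trans.
  rewrite -enumT; have := iota_ltn_sorted 0 (p + q).
  by rewrite -val_enum_ord sorted_map.
have -> : cl_basis F A = cl_basis F [set a in enum A].
  by congr (cl_basis F _); apply/setP => a; rewrite inE mem_enum.
elim: (enum A) srt => [|a s IHs] srt.
  by rewrite big_nil; congr (cl_basis F _); apply/setP => a; rewrite !inE.
have as_ : all (fun b : I => (a < b)%N) s.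
  by apply: order_path_min srt => b c d; exact: ltn_trans.
rewrite big_cons -IHs; last exact: path_sorted srt.
rewrite cl_basisM.
have -> : cl_sign F [set a] [set b in s] = 1.
  rewrite /cl_sign big_set1 big1 // => b; rewrite inE => /(allP as_) ab.
  by rewrite /cl_swap ltnNge (ltnW ab) /=; case: eqP ab => // ->; rewrite ltnn.
rewrite scale1r; congr (cl_basis F _); apply/setP => b.
rewrite in_symdiff !inE; case: eqP => //= ->.
by case: (boolP (a \in s)) => // /(allP as_); rewrite ltnn.
Qed.

Theorem cl_coordE (x : Cl) : x = \sum_A cl_coord x A *: cl_basis F A.
Proof.
apply: cl_coordP => B.
have -> : cl_coord (\sum_A cl_coord x A *: cl_basis F A) B =
    \sum_A cl_coord (cl_coord x A *: cl_basis F A) B.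
  by apply: (big_morph (fun y : Cl => cl_coord y B)) => [y z|];
    rewrite ?cl_coordD ?cl_coord0.
rewrite (bigD1 B) //= big1 => [|A AB].
  by rewrite cl_coordZ cl_coord_basis eqxx mulr1 addr0.
by rewrite cl_coordZ cl_coord_basis eq_sym (negPf AB) mulr0.
Qed.

Theorem cl_dim : \dim {: Cl} = (2 ^ (p + q))%N.
Proof.
by rewrite dimvf /dim /= muln1 -cardsT -powersetT card_powerset cardsT card_ord.
Qed.

End CliffordTheory.

Section BaseChange.
Variables (F K : fieldType) (f : {rmorphism F -> K}) (p q : nat).
Local Notation I := 'I_(p + q).

Definition cl_map (x : clifford F p q) : clifford K p q :=
  [ffun A => f (cl_coord x A) : K^o].

Lemma cl_coord_map x A : cl_coord (cl_map x) A = f (cl_coord x A).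
Proof. by rewrite /cl_coord ffunE. Qed.

Lemma cl_map_basis (A : {set I}) : cl_map (cl_basis F A) = cl_basis K A.
Proof.
by apply: cl_coordP => B; rewrite cl_coord_map !cl_coord_basis rmorph_nat.
Qed.

Lemma cl_mapZ c x : cl_map (c *: x) = f c *: cl_map x.
Proof.
by apply: cl_coordP => B; rewrite cl_coordZ !cl_coord_map cl_coordZ rmorphM.
Qed.

Fact cl_map_is_zmod_morphism : zmod_morphism cl_map.
Proof.
move=> x y; rewrite -scaleN1r -[- cl_map y]scaleN1r -(rmorphN1 f) -cl_mapZ.
by apply: cl_coordP => B; rewrite cl_coordD !cl_coord_map cl_coordD rmorphD.
Qed.

Fact cl_map_is_monoid_morphism : monoid_morphism cl_map.
Proof.
split=> [|x y]; first exact: cl_map_basis.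
apply: cl_coordP => C; rewrite cl_coord_map !cl_coordM rmorph_sum.
apply: eq_bigr => A _; rewrite !rmorphM !cl_coord_map; congr (_ * _).
rewrite /cl_sign rmorph_prod; apply: eq_bigr => a _.
rewrite rmorph_prod; apply: eq_bigr => b _.
rewrite /cl_swap !(fun_if f) rmorphN1 rmorph1 !mxE eqxx !mulr1n.
by rewrite (fun_if f) rmorphN1 rmorph1.
Qed.

HB.instance Definition _ :=
  GRing.isZmodMorphism.Build _ _ cl_map cl_map_is_zmod_morphism.
HB.instance Definition _ :=
  GRing.isMonoidMorphism.Build _ _ cl_map cl_map_is_monoid_morphism.

End BaseChange.

From mathcomp Require Import classical_sets reals topology normedtype derive.
From mathcomp Require Import complex.

Import numFieldNormedType.Exports.
Local Open Scope classical_set_scope.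

Variant scalars := RealScalars | ComplexScalars.

Definition scalar_field (R : realType) (s : scalars) : fieldType :=
  match s with
  | RealScalars => (R : fieldType)
  | ComplexScalars => (R[i] : fieldType)
  end.

Definition scalar_re (R : realType) (s : scalars) : scalar_field R s -> R :=
  match s with
  | RealScalars => id
  | ComplexScalars => @complex.Re R
  end.

Definition scalar_im (R : realType) (s : scalars) : scalar_field R s -> R :=
  match s with
  | RealScalars => fun=> 0
  | ComplexScalars => @complex.Im R
  end.

Section Smoothness.
Variables (R : realType) (r : nat).
Local Notation V := 'rV[R]_r.
Implicit Types (k : nat) (U : set V).

(* The library norm on 'rV[R]_r is the max norm; it has the same open sets. *)
Definition euclidean_norm (v : V) : R := Num.sqrt (\sum_i v 0 i ^+ 2).

Definition euclidean_ball (x0 : V) (eps : R) : set V :=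
  [set x | euclidean_norm (x - x0) < eps].

(* All iterated partial derivatives of f of order <= k exist and are
   continuous at every point of U. Functions on an open set U are represented
   by total functions, whose values outside U are irrelevant. *)
Fixpoint class_C k U (f : V -> R) : Prop :=
  (forall x, U x -> {for x, continuous f}) /\
  match k with
  | 0 => True
  | k'.+1 => forall i : 'I_r,
      (forall x, U x -> derivable f x (delta_mx 0 i)) /\
      class_C k' U ('D_(delta_mx 0 i) f)
  end.

(* Partial derivatives of a complex-valued function of real variables are taken
   on the real and imaginary parts. *)
Definition scalar_class_C (s : scalars) k U (f : V -> scalar_field R s) :
  Prop :=
  class_C k U (fun x => scalar_re (f x)) /\
  class_C k U (fun x => scalar_im (f x)).

Definition cl_class_C (s : scalars) (p q : nat) k U
  (f : V -> clifford (scalar_field R s) p q) : Prop :=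
  forall A, scalar_class_C k U (fun x => cl_coord (f x) A).

Definition intertwiner (s : scalars) (p q : nat) k U
  (h g : 'I_(p + q) -> V -> clifford (scalar_field R s) p q)
  (T : V -> clifford (scalar_field R s) p q) : Prop :=
  [/\ cl_class_C k U T,
      forall x, U x -> T x \is a GRing.unit
    & forall a x, U x -> g a x = (T x)^-1 * h a x * T x].

End Smoothness.

(* Main.v *)
(* For a family h satisfying the Clifford relations let h^A be the ordered
   product of the h^a, a in A. As n is even, every e^A with A nonempty
   anticommutes with some generator, so averaging x over the h^A, that is
   forming sum_A h^A x (h^A)^-1, projects x onto 2^n times its scalar part.
   Hence the h^A form a basis and the commutant of h consists of the scalars.
   For any F the element T_F = sum_A h^A F (g^A)^-1 satisfies
   h^a T_F = T_F g^a. Some T_F is nonzero at x0 since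
   sum_B T_(g^B) (g^B)^-1 = 2^n e, and then T_F S_G is a nonzero scalar at x0
   for some G, where S_G is built with h and g exchanged. With F and G fixed,
   T_F S_G is near x0 a nonvanishing scalar function c of class C^k, so T_F is
   invertible there. If T' is another intertwiner, T' S_G is a scalar d of
   class C^k and T' = (d / c) T_F. *)
From HB Require Import structures.
Require Import Defs.
From mathcomp Require Import all_boot all_order all_algebra all_field.

Set Implicit Arguments.
Unset Strict Implicit.
Unset Printing Implicit Defensive.
Import Order.TTheory GRing.Theory Num.Theory.
Local Open Scope ring_scope.

(** * Multiplication table of the ordered products of a Clifford family *)

Section CliffordFamilies.
Variables (F : fieldType) (p q : nat).
Hypothesis two_neq0 : (2 : F) != 0.
Local Notation I := 'I_(p + q).
Local Notation Cl := (clifford F p q).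
Implicit Types (g h : I -> Cl) (A B C : {set I}).

Definition clifford_family g := forall a b,
  g a * g b + g b * g a = (2 * cl_metric F p q a b) *: 1.

Lemma family_sqr g a : clifford_family g ->
  g a * g a = cl_metric F p q a a *: 1.
Proof.
move=> /(_ a a); rewrite -mulr2n -scaler_nat -scalerA.
move=> /(congr1 (GRing.scale 2^-1)).
by rewrite !scalerA mulrA mulVf // !mul1r scale1r.
Qed.

Lemma family_anti g a b : clifford_family g -> a != b ->
  g a * g b = - (g b * g a).
Proof.
move=> /(_ a b) gab ab; apply/eqP; rewrite -addr_eq0 gab mxE (negPf ab).
by rewrite mulr0n mulr0 scale0r.
Qed.

(** Filtering the fixed list [enum I], rather than listing A, lets a single induction compare the
    products over B and over [symdiff [set a] B]. *)
Definition family_prod g A : Cl := \prod_(a <- enum I | a \in A) g a.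

Lemma enum_ord_sorted : sorted (fun a b : I => (a < b)%N) (enum I).
Proof.
by have := iota_ltn_sorted 0 (p + q); rewrite -val_enum_ord sorted_map.
Qed.

Lemma family_prodE g A : family_prod g A = \prod_(a <- enum A) g a.
Proof. by rewrite [enum A]/enum_mem -enumT big_filter. Qed.

Lemma family_prod1 g a : family_prod g [set a] = g a.
Proof. by rewrite family_prodE enum_set1 big_seq1. Qed.

Lemma family_prod0 g : family_prod g set0 = 1.
Proof. by rewrite /family_prod big1 // => a; rewrite inE. Qed.

Lemma cl_sign_sqr A B : cl_sign F A B * cl_sign F A B = 1.
Proof. by rewrite -cl_signDl symdiff_id cl_sign0l. Qed.

(** The factor [g a] travels rightwards through the list of all indices, which is certain to contain
    a. Each smaller index lying in B costs a factor -1; at position a the factor is either inserted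
    or squared to [cl_metric]. *)
Lemma family_gen_prod g a B : clifford_family g ->
  g a * family_prod g B
    = cl_sign F [set a] B *: family_prod g (symdiff [set a] B).
Proof.
move=> gP; rewrite /family_prod /cl_sign big_set1.
have -> : \prod_(b in B) cl_swap F a b =
    \prod_(b <- enum I | b \in B) cl_swap F a b by rewrite big_enum_cond.
have srt := enum_ord_sorted.
have: a \in enum I by rewrite mem_enum.
elim: (enum I) srt => //= b s IHs srt.
have bs : all (fun c : I => (b < c)%N) s.
  by apply: order_path_min srt => c d e; exact: ltn_trans.
rewrite !big_cons inE => /predU1P[ab|a_s]; last first.
  have ba : (b < a)%N by move/allP: bs; apply.
  have nab : a != b by apply: contraTneq ba => ->; rewrite ltnn.
  have {}IHs := IHs (path_sorted srt) a_s.
  rewrite in_symdiff inE eq_sym (negPf nab) /=.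
  case: (b \in B); last exact: IHs.
  rewrite mulrA family_anti // mulNr -mulrA IHs /cl_swap ba mulN1r.
  by rewrite scaleNr scalerAr.
(* Position a is reached. All later indices exceed a, so they contribute no sign, and they lie in
   the symmetric difference exactly when they lie in B. *)
rewrite -{b}ab in srt bs *; rewrite in_symdiff inE eqxx /=.
have as_ c : c \in s -> (c != a) && ~~ (c < a)%N.
  move=> /(allP bs) ac; rewrite -leqNgt (ltnW ac) andbT.
  by apply: contraTneq ac => ->; rewrite ltnn.
have -> : \prod_(j <- s | j \in B) cl_swap F a j = 1.
  rewrite big_seq_cond big1 // => c /andP[/as_ /andP[ca nca] _].
  by rewrite /cl_swap (negPf nca) eq_sym (negPf ca).
have -> : \prod_(j <- s | j \in symdiff [set a] B) g j =
    \prod_(j <- s | j \in B) g j.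
  rewrite big_seq_cond [RHS]big_seq_cond; apply: eq_bigl => c.
  case: (boolP (c \in s)) => //= /as_ /andP[ca _].
  by rewrite in_symdiff inE (negPf ca).
case: (a \in B) => /=; last by rewrite scale1r.
by rewrite mulrA family_sqr // mulr1 /cl_swap ltnn eqxx -scalerAl mul1r.
Qed.

(** The g^A multiply exactly like the basis elements e^A. Induction on A peels off its smallest
    element a, which splits off without a sign ([sign1]); bimultiplicativity of [cl_sign] does the
    rest. *)
Lemma family_prodM g A B : clifford_family g ->
  family_prod g A * family_prod g B
    = cl_sign F A B *: family_prod g (symdiff A B).
Proof.
move=> gP; rewrite [family_prod g A]family_prodE.
have -> : A = [set a in enum A] by apply/setP=> a; rewrite inE mem_enum.
have -> : enum [set a in enum A] = enum A.
  by apply: eq_enum => a; rewrite !inE mem_enum.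
have: sorted (fun a b : I => (a < b)%N) (enum A).
  rewrite /enum_mem -enumT; apply: sorted_filter enum_ord_sorted.
  by move=> a b c; exact: ltn_trans.
elim: (enum A) => [_|a s IHs srt].
  have -> : [set a in [::]] = set0 :> {set I} by apply/setP => a; rewrite !inE.
  by rewrite big_nil mul1r cl_sign0l symdiffC symdiff0 scale1r.
have as_ : all (fun b : I => (a < b)%N) s.
  by apply: order_path_min srt => b c d; exact: ltn_trans.
have -> : [set b in a :: s] = symdiff [set a] [set b in s].
  apply/setP => b; rewrite in_symdiff !inE; case: eqVneq => //= ->.
  by case: (boolP (a \in s)) => // /(allP as_); rewrite ltnn.
have sign1 : cl_sign F [set a] [set b in s] = 1.
  rewrite /cl_sign big_set1 big1 // => b; rewrite inE => /(allP as_) ab.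
  by rewrite /cl_swap ltnNge (ltnW ab) /=; case: eqP ab => // ->; rewrite ltnn.
rewrite big_cons -mulrA IHs ?(path_sorted srt) // -scalerAr family_gen_prod //.
by rewrite scalerA cl_signDr sign1 mul1r mulrC -cl_signDl symdiffA.
Qed.

(** * Averaging over the ordered products for even n *)

Hypothesis n_even : ~~ odd (p + q).

(** The product of the two signs is -1 to the number of elements of A other than b. If #|A| is odd,
    b is taken outside A, which is possible because n is even; if #|A| is even, b is taken inside A.
    This is where the parity of n enters. *)
Lemma anticommuting_gen A : A != set0 ->
  exists b, cl_sign F [set b] A * cl_sign F A [set b] = -1.
Proof.
move=> A0.
have swapE b : cl_sign F [set b] A * cl_sign F A [set b] =
    \prod_(a in A) (if a == b then 1 else -1).
  rewrite /cl_sign big_set1 -big_split; apply: eq_bigr => a _ /=.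
  rewrite big_set1; case: eqVneq => [->|ab]; first exact: cl_swap_sqr.
  rewrite /cl_swap [b == a]eq_sym (negPf ab).
  by case: ltngtP => [||e]; rewrite ?mulr1 ?mul1r //; case/eqP: ab; apply: val_inj.
case: (boolP (odd #|A|)) => [oddA|evenA].
  have /existsP[b bA] : [exists b, b \notin A].
    rewrite -negb_forall; apply: contraL oddA => /forallP fullA.
    have -> : A = setT by apply/setP => a; rewrite fullA inE.
    by rewrite cardsT card_ord.
  exists b; rewrite swapE (eq_bigr (fun=> -1)) => [|a aA].
    by rewrite prodr_const -signr_odd oddA.
  by case: eqP aA => // ->; rewrite (negPf bA).
have /set0Pn[b bA] := A0; exists b; rewrite swapE (big_setD1 b) //= eqxx mul1r.
rewrite (eq_bigr (fun=> -1)) => [|a]; last by rewrite !inE => /andP[/negPf->].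
rewrite prodr_const -signr_odd; move: evenA; rewrite (cardsD1 b) bA /= negbK.
by move=> ->.
Qed.

(* B |-> cl_sign B A * cl_sign A B is a character of the group of subsets under
   symmetric difference, nontrivial when A is nonempty. *)
Lemma sum_cl_sign A :
  \sum_B cl_sign F B A * cl_sign F A B = (2 ^+ (p + q)) *+ (A == set0).
Proof.
case: eqVneq => [->|/anticommuting_gen[b bA]].
  rewrite (eq_bigr (fun=> 1)) => [|B _]; last by rewrite cl_sign0l cl_sign0r mulr1.
  rewrite sumr_const mulr1n -natrX; congr (_ *+ _).
  by rewrite -cardsT -powersetT card_powerset cardsT card_ord.
set S := \sum_B _; apply/eqP; rewrite mulr0n.
have : S = - S.
  rewrite {1}/S (reindex_inj (can_inj (symdiffK [set b]))) -sumrN /=.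
  by apply: eq_bigr => B _; rewrite cl_signDl cl_signDr mulrACA bA mulN1r.
move/eqP; rewrite -addr_eq0 -mulr2n -mulr_natl mulf_eq0.
by rewrite (negPf two_neq0).
Qed.

(* (g^A)^-1 = cl_sign A A *: g^A. *)
Definition intertwining h g x : Cl :=
  \sum_A cl_sign F A A *: (family_prod h A * x * family_prod g A).

Lemma intertwining_is_linear h g : linear (intertwining h g).
Proof.
move=> c x y; rewrite /intertwining scaler_sumr -big_split.
apply: eq_bigr => A _ /=; rewrite mulrDr mulrDl scalerDr -scalerAr -scalerAl.
by rewrite !scalerA mulrC.
Qed.
HB.instance Definition _ h g := GRing.isLinear.Build F Cl Cl *:%R
  (intertwining h g) (@intertwining_is_linear h g).

(** Multiplication by h^B permutes the terms through the substitution of [symdiff B A] for A, and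
    bimultiplicativity of [cl_sign] makes the signs agree. *)
Lemma intertwining_prod h g x B : clifford_family h -> clifford_family g ->
  family_prod h B * intertwining h g x = intertwining h g x * family_prod g B.
Proof.
move=> hP gP; rewrite mulr_sumr mulr_suml.
rewrite (reindex_inj (can_inj (symdiffK B))) /=; apply: eq_bigr => A _.
rewrite -scalerAr -scalerAl !mulrA (family_prodM _ _ hP) symdiffK.
rewrite -[in RHS](mulrA (_ * x)) (family_prodM _ _ gP) -!scalerAl -scalerAr !scalerA.
rewrite [symdiff A B]symdiffC; congr (_ *: _).
by rewrite mulrC -cl_signDl symdiffK cl_signDr mulrC.
Qed.

Lemma intertwining_gen h g x a : clifford_family h -> clifford_family g ->
  h a * intertwining h g x = intertwining h g x * g a.
Proof.
by move=> hP gP; have := intertwining_prod x [set a] hP gP; rewrite !family_prod1.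
Qed.

(** Conjugating g^A by g^B only multiplies it by a sign, and these signs add up to the character sum
    [sum_cl_sign]. *)
Lemma intertwining_family_prod g A : clifford_family g ->
  intertwining g g (family_prod g A) = (2 ^+ (p + q) *+ (A == set0)) *: 1.
Proof.
move=> gP; have -> : intertwining g g (family_prod g A) =
    (\sum_B cl_sign F B A * cl_sign F A B) *: family_prod g A.
  rewrite scaler_suml; apply: eq_bigr => B _.
  rewrite !family_prodM // -scalerAl family_prodM // !scalerA.
  rewrite [symdiff B A]symdiffC -symdiffA symdiff_id symdiff0 cl_signDl.
  by rewrite [cl_sign F A B * _]mulrC mulrACA cl_sign_sqr mul1r.
rewrite sum_cl_sign; case: eqVneq => [->|_]; first by rewrite family_prod0.
by rewrite mulr0n !scale0r.
Qed.

Lemma intertwining_commuting g x : clifford_family g ->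
  (forall a, g a * x = x * g a) -> intertwining g g x = 2 ^+ (p + q) *: x.
Proof.
move=> gP gx; have gAx A : family_prod g A * x = x * family_prod g A.
  apply: (big_ind (fun y => y * x = x * y)) => [|y z yx zx|a _ //].
    by rewrite mul1r mulr1.
  by rewrite -mulrA zx mulrA yx mulrA.
have := intertwining_family_prod set0 gP; rewrite family_prod0 eqxx mulr1n.
move=> e; rewrite -[in RHS](mulr1 x) scalerAr -e /intertwining mulr_sumr.
by apply: eq_bigr => A _; rewrite gAx mulr1 -scalerAr mulrA.
Qed.

Lemma pow2_neq0 : 2 ^+ (p + q) != 0 :> F.
Proof. by rewrite expf_neq0. Qed.

(** The linear endomorphism taking e^A to g^A is injective, hence bijective by finite dimension; c
    consists of the coordinates of the preimage of x. *)
Lemma family_prod_span g x : clifford_family g ->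
  exists c : {set I} -> F, x = \sum_A c A *: family_prod g A.
Proof.
move=> gP.
pose f (y : Cl) : Cl := \sum_A cl_coord y A *: family_prod g A.
have f_lin : linear f.
  move=> c y z; rewrite /f scaler_sumr -big_split; apply: eq_bigr => A _ /=.
  by rewrite cl_coordD cl_coordZ scalerDl scalerA.
pose fL : {linear Cl -> Cl} := HB.pack f (GRing.isLinear.Build _ _ _ _ f f_lin).
suff kf : lker (linfun fL) == 0%VS.
  exists (cl_coord ((linfun fL)^-1%VF x)).
  by have := lker0_lfunVK kf x; rewrite lfunE.
apply/lker0P => y z; rewrite !lfunE => fyz; apply/eqP; rewrite -subr_eq0.
have : f (y - z) = 0 by rewrite -[f _]/(fL _) linearB fyz subrr.
move: (y - z) => {fyz x y z} y fy0; apply/eqP/cl_coordP => A.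
(* After multiplication by g^A, averaging keeps only the term B = A, so the relation isolates the
   coordinate of y at A. *)
have /(congr1 (intertwining g g)) := congr1 (fun u => u * family_prod g A) fy0.
rewrite mul0r linear0 mulr_suml linear_sum (bigD1 A) //= big1 ?addr0 => [|B BA].
  rewrite -scalerAl family_prodM // !linearZ /= intertwining_family_prod //.
  rewrite symdiff_id eqxx mulr1n !scalerA => /eqP; rewrite scaler_eq0.
  rewrite oner_eq0 orbF !mulf_eq0 (negPf pow2_neq0) orbF cl_coord0.
  case/orP => [/eqP->//|/eqP s0]; have /eqP := cl_sign_sqr A A.
  by rewrite s0 mul0r eq_sym oner_eq0.
rewrite -scalerAl family_prodM // !linearZ /= intertwining_family_prod //.
case: eqP => [e|_]; last by rewrite mulr0n scale0r !scaler0.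
by case/eqP: BA; rewrite -(symdiffK B A) e symdiff0.
Qed.

Lemma intertwining_scalar g x : clifford_family g ->
  exists c, intertwining g g x = c *: 1.
Proof.
move=> gP; have [c ->] := family_prod_span x gP.
exists (\sum_A c A * (2 ^+ (p + q) *+ (A == set0))).
rewrite linear_sum scaler_suml; apply: eq_bigr => A _.
by rewrite linearZ /= intertwining_family_prod // scalerA.
Qed.

(** Averaging multiplies x by 2^n and also yields a scalar. The scalar is named as a coordinate of x
    so that it inherits the class C^k when x varies. *)
Lemma family_commutant g x : clifford_family g ->
  (forall a, g a * x = x * g a) -> x = cl_coord x set0 *: 1.
Proof.
move=> gP gx; have [c] := intertwining_scalar x gP.
rewrite intertwining_commuting // => /(congr1 (GRing.scale (2 ^+ (p + q))^-1)).
rewrite !scalerA mulVf ?pow2_neq0 // scale1r => ->.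
by rewrite cl_coordZ cl_coord_basis eqxx mulr1.
Qed.

Lemma intertwining_neq0 h g : clifford_family h -> clifford_family g ->
  exists x, intertwining h g x != 0.
Proof.
move=> hP gP.
suff /existsP[B TB] : [exists B, intertwining h g (family_prod g B) != 0].
  by exists (family_prod g B).
apply: contraT; rewrite negb_exists => /forallP T0.
have : \sum_B cl_sign F B B *:
    (intertwining h g (family_prod g B) * family_prod g B) = 0.
  by rewrite big1 // => B _; have /negPn/eqP-> := T0 B; rewrite mul0r scaler0.
(* Exchanging the two sums turns the sum over B into an average of g^A over the family g, which
   vanishes unless A is empty. *)
have -> : \sum_B cl_sign F B B *:
    (intertwining h g (family_prod g B) * family_prod g B) =
    \sum_A cl_sign F A A *:
      (family_prod h A * intertwining g g (family_prod g A)).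
  under eq_bigr => B _ do rewrite mulr_suml scaler_sumr.
  rewrite exchange_big; apply: eq_bigr => A _ /=.
  rewrite mulr_sumr scaler_sumr; apply: eq_bigr => B _.
  by rewrite -!scalerAl -!scalerAr !scalerA mulrC !mulrA.
rewrite (bigD1 set0) //= big1 ?addr0 => [|A A0].
  rewrite intertwining_family_prod // eqxx family_prod0 mul1r mulr1n cl_sign0l.
  by move/eqP; rewrite scale1r scaler_eq0 oner_eq0 orbF (negPf pow2_neq0).
by rewrite intertwining_family_prod // (negPf A0) mulr0n scale0r mulr0 scaler0.
Qed.

(** The left factor turns each g^A into h^A as it moves past it. The product is therefore an average
    over h, hence a scalar. *)
Lemma intertwiningM h g x y : clifford_family h -> clifford_family g ->
  intertwining h g x * intertwining g h y
    = intertwining h h (intertwining h g x * y).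
Proof.
move=> hP gP; rewrite mulr_sumr; apply: eq_bigr => A _.
by rewrite -scalerAr !mulrA intertwining_prod.
Qed.

Lemma intertwining_pair h g : clifford_family h -> clifford_family g ->
  exists x y c, c != 0 /\ intertwining h g x * intertwining g h y = c *: 1.
Proof.
move=> hP gP; have [x T0] := intertwining_neq0 hP gP.
have [c Tc] := family_prod_span (intertwining h g x) hP.
have [A cA] : exists A, c A != 0.
  apply/existsP; apply: contraNT T0; rewrite negb_exists => /forallP c0.
  by rewrite Tc big1 // => A _; have /negPn/eqP-> := c0 A; rewrite scale0r.
(* With c A a nonzero coefficient of the first factor in the basis h^B, taking y = h^A makes the
   average of the product read off that coefficient. *)
exists x, (family_prod h A), (c A * (cl_sign F A A * 2 ^+ (p + q))); split.
  rewrite !mulf_neq0 ?pow2_neq0 //; apply/eqP => s0.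
  by have /eqP := cl_sign_sqr A A; rewrite s0 mul0r eq_sym oner_eq0.
rewrite intertwiningM // Tc mulr_suml linear_sum (bigD1 A) //= big1 => [|B BA].
  rewrite addr0 -scalerAl family_prodM // !linearZ /= intertwining_family_prod //.
  by rewrite symdiff_id eqxx mulr1n !scalerA mulrA.
rewrite -scalerAl family_prodM // !linearZ /= intertwining_family_prod //.
case: eqP => [e|_]; last by rewrite mulr0n scale0r !scaler0.
by case/eqP: BA; rewrite -(symdiffK B A) e symdiff0.
Qed.

(** The element y x commutes with every [g a], so it is a scalar d. Computing x y x in two ways
    gives c x = d x with x nonzero, so d = c. *)
Lemma intertwiner_unit h g x y c : clifford_family g ->
  (forall a, h a * x = x * g a) -> (forall a, g a * y = y * h a) ->
  c != 0 -> x * y = c *: 1 -> x \is a GRing.unit /\ y * x = c *: 1.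
Proof.
move=> gP hx gy c0 xy.
have /(family_commutant gP) yx a : g a * (y * x) = y * x * g a.
  by rewrite mulrA gy -mulrA hx mulrA.
have x0 : x != 0.
  apply: contraNneq c0 => x0; move/eqP: xy; rewrite x0 mul0r eq_sym.
  by rewrite scaler_eq0 oner_eq0 orbF.
have {}yx : y * x = c *: 1.
  have /eqP := mulrA x y x; rewrite xy {1}yx -scalerAr -scalerAl mulr1 mul1r.
  rewrite -subr_eq0 -scalerBl scaler_eq0 (negPf x0) orbF subr_eq0 => /eqP yxc.
  by rewrite yx yxc.
split=> //; apply/unitrP; exists (c^-1 *: y).
by rewrite -scalerAl -scalerAr yx xy scalerA mulVf // scale1r.
Qed.
End CliffordFamilies.

From mathcomp Require Import classical_sets reals topology normedtype derive.
From mathcomp Require Import realfun complex.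
Import numFieldNormedType.Exports.
Local Open Scope classical_set_scope.
Local Open Scope ring_scope.

(** * Calculus of real functions of class C^k on an open set *)

Section ClassC.
Variables (R : realType) (r : nat) (U : set 'rV[R]_r).
Hypothesis U_open : open U.
Implicit Types (f g : 'rV[R]_r -> R) (k : nat).

Lemma near_open x (P : 'rV[R]_r -> Prop) : U x -> (forall y, U y -> P y) ->
  \forall y \near x, P y.
Proof.
by move=> Ux UP; apply: filterS UP _; apply: open_nbhs_nbhs; split.
Qed.

Lemma continuous_ext_open f g x : U x -> (forall y, U y -> f y = g y) ->
  {for x, continuous f} -> {for x, continuous g}.
Proof.
move=> Ux fg; rewrite /prop_for /continuous_at -(fg x Ux).
apply: cvg_trans; apply: (@near_eq_cvg _ _ (nbhs x)).
exact: near_open Ux fg.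
Qed.

Lemma class_C_continuous k f x : class_C k U f -> U x -> {for x, continuous f}.
Proof. by case: k => [|k] [fc _]; exact: fc. Qed.

(** As U is open, equality on U is equality near each of its points, so limits and directional
    derivatives agree there. *)
Lemma class_C_ext k f g : (forall x, U x -> f x = g x) ->
  class_C k U f -> class_C k U g.
Proof.
elim: k f g => [|k IHk] f g fg [fc fd].
  split=> // x Ux; exact: continuous_ext_open fg (fc x Ux).
split=> [x Ux|i]; first exact: continuous_ext_open fg (fc x Ux).
have [fdi fdC] := fd i; split=> [x Ux|].
  exact: near_eq_derivable (near_open Ux fg) (fdi x Ux).
apply: IHk fdC => x Ux; exact: near_eq_derive (near_open Ux fg).
Qed.

Lemma class_C_pred k f : class_C k.+1 U f -> class_C k U f.
Proof.
elim: k f => [|k IHk] f [fc fd]; first by [].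
by split=> // i; have [fdi fdC] := fd i; split=> //; exact: IHk.
Qed.

Lemma class_C_cst k (c : R) : class_C k U (fun=> c).
Proof.
elim: k c => [|k IHk] c; (split; first by move=> x _; exact: cst_continuous) => // i.
split=> [x _|]; first exact: derivable_cst.
by apply: class_C_ext (IHk 0) => x _; rewrite derive_cst.
Qed.

Lemma class_C_add k f g : class_C k U f -> class_C k U g ->
  class_C k U (fun x => f x + g x).
Proof.
elim: k f g => [|k IHk] f g [fc fd] [gc gd];
  (split; first by move=> x Ux; exact: continuousD (fc x Ux) (gc x Ux)) => // i.
have [[fdi fdC] [gdi gdC]] := (fd i, gd i); split=> [x Ux|].
  exact: derivableD (fdi x Ux) (gdi x Ux).
apply: class_C_ext (IHk _ _ fdC gdC) => x Ux.
by rewrite -(deriveD (fdi x Ux) (gdi x Ux)).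
Qed.

Lemma class_C_mul k f g : class_C k U f -> class_C k U g ->
  class_C k U (fun x => f x * g x).
Proof.
elim: k f g => [|k IHk] f g fC gC; have [fc fd] := fC; have [gc gd] := gC;
  (split; first by move=> x Ux; exact: continuousM (fc x Ux) (gc x Ux)) => // i.
have [[fdi fdC] [gdi gdC]] := (fd i, gd i); split=> [x Ux|].
  exact: derivableM (fdi x Ux) (gdi x Ux).
(* In the Leibniz rule each summand keeps one undifferentiated factor, whose order is lowered by
   [class_C_pred]. *)
have fgC := IHk _ _ (class_C_pred fC) gdC.
have gfC := IHk _ _ (class_C_pred gC) fdC.
apply: class_C_ext (class_C_add fgC gfC) => x Ux.
by rewrite -/(GRing.scale (f x) _) -(deriveM (fdi x Ux) (gdi x Ux)).
Qed.

Lemma class_C_inv k f : (forall x, U x -> f x != 0) -> class_C k U f ->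
  class_C k U (fun x => (f x)^-1).
Proof.
move=> f0; elim: k => [|k IHk] fC; have [fc fd] := fC;
  (split; first by move=> x Ux; exact: continuousV (f0 x Ux) (fc x Ux)) => // i.
have [fdi fdC] := fd i; split=> [x Ux|].
  exact: derivableV (f0 x Ux) (fdi x Ux).
have fVC := IHk (class_C_pred fC).
have := class_C_mul (class_C_cst k (-1)) (class_C_mul (class_C_mul fVC fVC) fdC).
apply: class_C_ext => x Ux; rewrite (deriveV (f0 x Ux) (fdi x Ux)).
by rewrite mulN1r -mulNr -exprVn expr2.
Qed.
End ClassC.

(** * Real and complex scalar functions of class C^k *)

Section ScalarClassC.
Variables (R : realType) (s : scalars) (r : nat) (U : set 'rV[R]_r).
Hypothesis U_open : open U.
Local Notation F := (scalar_field R s).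
Implicit Types (f g : 'rV[R]_r -> F) (k : nat).

Lemma scalar_class_C_ext k f g : (forall x, U x -> f x = g x) ->
  scalar_class_C k U f -> scalar_class_C k U g.
Proof.
move=> fg [reC imC]; split; [apply: class_C_ext reC | apply: class_C_ext imC];
  by move=> // x Ux; rewrite fg.
Qed.

Lemma scalar_class_C_cst k (c : F) : scalar_class_C k U (fun=> c).
Proof. by split; exact: class_C_cst. Qed.

Lemma scalar_class_C_add k f g : scalar_class_C k U f ->
  scalar_class_C k U g -> scalar_class_C k U (fun x => f x + g x).
Proof.
move=> [fre fim] [gre gim].
split; [apply: class_C_ext (class_C_add U_open fre gre) |
  apply: class_C_ext (class_C_add U_open fim gim)] => // x _ {fre fim gre gim}.
- by move: (f x) (g x) => a b; destruct s; [|case: a b => ? ? [? ?]].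
- by move: (f x) (g x) => a b; destruct s => /=; [rewrite addr0|case: a b => ? ? [? ?]].
Qed.

Lemma scalar_class_C_mul k f g : scalar_class_C k U f ->
  scalar_class_C k U g -> scalar_class_C k U (fun x => f x * g x).
Proof.
move=> [fre fim] [gre gim].
have mC := class_C_mul U_open; have aC := class_C_add U_open.
have m1C := class_C_cst U_open k (-1).
split; [apply: class_C_ext (aC _ _ _ (mC _ _ _ fre gre)
    (mC _ _ _ m1C (mC _ _ _ fim gim))) |
  apply: class_C_ext (aC _ _ _ (mC _ _ _ fre gim) (mC _ _ _ fim gre))]
  => // x _ {fre fim gre gim}.
- move: (f x) (g x) => a b; destruct s => /=; first by rewrite !mulr0 addr0.
  by case: a b => ? ? [? ?] /=; rewrite mulN1r.
- move: (f x) (g x) => a b; destruct s => /=; first by rewrite mulr0 mul0r addr0.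
  by case: a b => ? ? [? ?] /=.
Qed.

(** The squared modulus takes values in R for both scalar fields, which reduces inversion to real
    division: the inverse of c is its conjugate divided by this number. *)
Definition scalar_normsq (c : F) : R := scalar_re c ^+ 2 + scalar_im c ^+ 2.

Lemma scalar_normsq_eq0 c : (scalar_normsq c == 0) = (c == 0).
Proof.
rewrite /scalar_normsq paddr_eq0 ?sqr_ge0 // !sqrf_eq0.
by destruct s; rewrite /= ?eqxx ?andbT //; case: c => a b; rewrite eq_complex.
Qed.

Lemma class_C_normsq k f : scalar_class_C k U f ->
  class_C k U (fun x => scalar_normsq (f x)).
Proof.
by move=> [fre fim]; apply: class_C_add => //; apply: class_C_mul.
Qed.

Lemma scalar_class_C_inv k f : (forall x, U x -> f x != 0) ->
  scalar_class_C k U f -> scalar_class_C k U (fun x => (f x)^-1).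
Proof.
move=> f0 fC; have [fre fim] := fC.
have nC : class_C k U (fun x => (scalar_normsq (f x))^-1).
  apply: class_C_inv (class_C_normsq fC) => // x Ux.
  by rewrite scalar_normsq_eq0 f0.
have mC := class_C_mul U_open; have m1C := class_C_cst U_open k (-1).
split; [apply: class_C_ext (mC _ _ _ fre nC) |
  apply: class_C_ext (mC _ _ _ m1C (mC _ _ _ fim nC))]
  => // x /f0; move: (f x) => a {f0 fC fre fim nC mC m1C};
  rewrite /scalar_normsq; destruct s; rewrite /= in a *.
- by move=> a0; rewrite expr0n addr0 expr2 invfM mulrA divff ?mul1r.
- by case: a.
- by rewrite mul0r mulr0.
- by case: a => b c _ /=; rewrite mulN1r.
Qed.

Lemma scalar_neq0_nbhs k f x : scalar_class_C k U f -> U x -> f x != 0 ->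
  \forall y \near x, f y != 0.
Proof.
move=> fC Ux fx0; have nc := class_C_continuous (class_C_normsq fC) Ux.
have : \forall y \near x, scalar_normsq (f y) != 0.
  apply: (nc [set t | t != 0]).
  by apply: open_nbhs_nbhs; split; [exact: open_neq|rewrite /= scalar_normsq_eq0].
by apply: filterS => y; rewrite scalar_normsq_eq0.
Qed.
End ScalarClassC.

(** * Euclidean balls against the max-norm topology *)

Section EuclideanBall.
Variables (R : realType) (r : nat).
Implicit Types (x v : 'rV[R]_r) (e : R).

Lemma coord_le_euclidean_norm v i : `|v 0 i| <= euclidean_norm v.
Proof.
rewrite -sqrtr_sqr ler_wsqrtr // (bigD1 i) //= lerDl.
by apply: sumr_ge0 => j _; exact: sqr_ge0.
Qed.

Lemma euclidean_ball_nbhs x (P : set 'rV[R]_r) : nbhs x P ->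
  exists e, 0 < e /\ euclidean_ball x e `<=` P.
Proof.
case/nbhs_ballP => e /= e0 eP; exists e; split=> // y xy; apply: eP.
(* The max norm is dominated by the Euclidean norm, so the same radius e works. *)
split=> // i j; rewrite ord1 /ball /= distrC.
by have := coord_le_euclidean_norm (y - x) j; rewrite !mxE => /le_lt_trans; apply.
Qed.

Lemma euclidean_norm_continuous : continuous (@euclidean_norm R r).
Proof.
move=> v; apply: continuous_comp; last exact: sqrt_continuous.
apply: continuous_big => [|i _ w]; first exact: add_continuous.
have ci := @coord_continuous R 1 r 0 i w; exact: (continuousM ci ci).
Qed.

Lemma euclidean_ball_open x e : open (euclidean_ball x e).
Proof.
have -> : euclidean_ball x e = (fun y => euclidean_norm (y - x)) @^-1` [set t | t < e].
  by [].
apply: open_comp; last exact: open_lt.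
move=> y _; have xc : {for y, continuous (fun z : 'rV[R]_r => z - x)}.
  apply: (@continuousB _ _ _ id (fun=> x)); last exact: cst_continuous.
  by move=> A.
exact: (continuous_comp xc (@euclidean_norm_continuous (y - x))).
Qed.
End EuclideanBall.

(** * Clifford-valued functions of class C^k *)

Section CliffordClassC.
Variables (R : realType) (s : scalars) (p q r : nat) (U : set 'rV[R]_r).
Hypothesis U_open : open U.
Local Notation F := (scalar_field R s).
Local Notation Cl := (clifford F p q).
Implicit Types (f g : 'rV[R]_r -> Cl) (k : nat).

Lemma scalar_class_C_sum k (J : Type) (e : seq J) (f : J -> 'rV[R]_r -> F) :
  (forall j, scalar_class_C k U (f j)) ->
  scalar_class_C k U (fun x => \sum_(j <- e) f j x).
Proof.
move=> fC; elim: e => [|j e IHe].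
  by apply: scalar_class_C_ext (scalar_class_C_cst U_open k 0) => // x _;
    rewrite big_nil.
apply: scalar_class_C_ext (scalar_class_C_add U_open (fC j) IHe) => // x _.
by rewrite big_cons.
Qed.

Lemma cl_class_C_ext k f g : (forall x, U x -> f x = g x) ->
  cl_class_C k U f -> cl_class_C k U g.
Proof.
by move=> fg fC A; apply: scalar_class_C_ext (fC A) => // x Ux; rewrite fg.
Qed.

Lemma cl_class_C_cst k (c : Cl) : cl_class_C k U (fun=> c).
Proof. by move=> A; exact: scalar_class_C_cst. Qed.

Lemma cl_class_C_add k f g : cl_class_C k U f -> cl_class_C k U g ->
  cl_class_C k U (fun x => f x + g x).
Proof.
move=> fC gC A; apply: scalar_class_C_ext (scalar_class_C_add U_open (fC A) (gC A)).
  by [].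
by move=> x _; rewrite cl_coordD.
Qed.

Lemma cl_class_C_scale k (c : 'rV[R]_r -> F) f : scalar_class_C k U c ->
  cl_class_C k U f -> cl_class_C k U (fun x => c x *: f x).
Proof.
move=> cC fC A; apply: scalar_class_C_ext (scalar_class_C_mul U_open cC (fC A)).
  by [].
by move=> x _; rewrite cl_coordZ.
Qed.

Lemma cl_class_C_mul k f g : cl_class_C k U f -> cl_class_C k U g ->
  cl_class_C k U (fun x => f x * g x).
Proof.
move=> fC gC C.
apply: (@scalar_class_C_ext _ _ _ _ U_open _ (fun x =>
    \sum_A cl_sign F A (symdiff A C)
      * (cl_coord (f x) A * cl_coord (g x) (symdiff A C)))) => [x _|].
  by rewrite cl_coordM.
apply: scalar_class_C_sum => A.
by do 2?[apply: scalar_class_C_mul => //]; exact: scalar_class_C_cst.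
Qed.

Lemma cl_class_C_sum k (J : Type) (e : seq J) (f : J -> 'rV[R]_r -> Cl) :
  (forall j, cl_class_C k U (f j)) ->
  cl_class_C k U (fun x => \sum_(j <- e) f j x).
Proof.
move=> fC; elim: e => [|j e IHe].
  by apply: cl_class_C_ext (cl_class_C_cst k 0) => x _; rewrite big_nil.
apply: cl_class_C_ext (cl_class_C_add (fC j) IHe) => x _.
by rewrite big_cons.
Qed.

Lemma cl_class_C_prod k (J : Type) (e : seq J) (f : J -> 'rV[R]_r -> Cl) :
  (forall j, cl_class_C k U (f j)) ->
  cl_class_C k U (fun x => \prod_(j <- e) f j x).
Proof.
move=> fC; elim: e => [|j e IHe].
  by apply: cl_class_C_ext (cl_class_C_cst k 1) => x _; rewrite big_nil.
apply: cl_class_C_ext (cl_class_C_mul (fC j) IHe) => x _.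
by rewrite big_cons.
Qed.

(** With y independent of x, this is a polynomial expression in the values of h and g. *)
Lemma cl_class_C_intertwining k (h g : 'I_(p + q) -> 'rV[R]_r -> Cl) (y : Cl) :
  (forall a, cl_class_C k U (h a)) -> (forall a, cl_class_C k U (g a)) ->
  cl_class_C k U (fun x => intertwining (h^~ x) (g^~ x) y).
Proof.
have prodC (f : 'I_(p + q) -> 'rV[R]_r -> Cl) A :
    (forall a, cl_class_C k U (f a)) ->
    cl_class_C k U (fun x => family_prod (f^~ x) A).
  move=> fC; apply: cl_class_C_ext (cl_class_C_prod (enum A) fC) => x _.
  by rewrite family_prodE.
move=> hC gC; apply: cl_class_C_sum => A; apply: cl_class_C_scale.
  exact: scalar_class_C_cst.
apply: cl_class_C_mul; last exact: prodC.
by apply: cl_class_C_mul; [exact: prodC|exact: cl_class_C_cst].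
Qed.
End CliffordClassC.

(** * Restriction to a ball and construction of the local intertwiner *)

Lemma class_C_sub (R : realType) (r : nat) (U W : set 'rV[R]_r) k f :
  U `<=` W -> class_C k W f -> class_C k U f.
Proof.
move=> UW; elim: k f => [|k IHk] f [fc fd];
  (split; first by move=> x /UW; exact: fc) => // i.
by have [fdi fdC] := fd i; split=> [x /UW|]; [exact: fdi|exact: IHk].
Qed.

Lemma cl_class_C_sub (R : realType) s p q (r : nat) (U W : set 'rV[R]_r) k
    (f : 'rV[R]_r -> clifford (scalar_field R s) p q) :
  U `<=` W -> cl_class_C k W f -> cl_class_C k U f.
Proof. by move=> UW fC A; have [] := fC A; split; apply: class_C_sub UW _. Qed.

Lemma scalar_two_neq0 (R : realType) s : (2 : scalar_field R s) != 0.
Proof. by destruct s; rewrite pnatr_eq0. Qed.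

Theorem theorem1 (R : realType) (s : scalars) (p q : nat)
    (n_gt0 : (0 < p + q)%N) (n_even : ~~ odd (p + q))
    (r k : nat) (Omega : set 'rV[R]_r) (Omega_open : open Omega)
    (h g : 'I_(p + q) -> 'rV[R]_r -> clifford (scalar_field R s) p q)
    (h_Ck : forall a, cl_class_C k Omega (h a))
    (g_Ck : forall a, cl_class_C k Omega (g a))
    (h_rel : forall a b x, Omega x ->
       h a x * h b x + h b x * h a x
         = (2 * cl_metric (scalar_field R s) p q a b) *: 1)
    (g_rel : forall a b x, Omega x ->
       g a x * g b x + g b x * g a x
         = (2 * cl_metric (scalar_field R s) p q a b) *: 1)
    (x0 : 'rV[R]_r) (x0_Omega : Omega x0) :
  exists eps : R,
    [/\ 0 < eps,
        euclidean_ball x0 eps `<=` Omega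
      & exists T : 'rV[R]_r -> clifford (scalar_field R s) p q,
          intertwiner k (euclidean_ball x0 eps) h g T /\
          forall T' : 'rV[R]_r -> clifford (scalar_field R s) p q,
            intertwiner k (euclidean_ball x0 eps) h g T' <->
            exists lambda : 'rV[R]_r -> scalar_field R s,
              [/\ scalar_class_C k (euclidean_ball x0 eps) lambda,
                  forall x, euclidean_ball x0 eps x -> lambda x != 0
                & forall x, euclidean_ball x0 eps x ->
                    T' x = lambda x *: T x]].
Proof.
have two0 := scalar_two_neq0 R s.
have hP x : Omega x -> clifford_family (h^~ x) by move=> Ox a b; exact: h_rel.
have gP x : Omega x -> clifford_family (g^~ x) by move=> Ox a b; exact: g_rel.
(* The elements y and z are chosen at x0 only and then kept constant, so that T and S are of class
   C^k on all of Omega. *)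
have [y [z [d0 [d0_neq0 TS0]]]] :=
  intertwining_pair two0 n_even (hP _ x0_Omega) (gP _ x0_Omega).
pose T x := intertwining (h^~ x) (g^~ x) y.
pose S x := intertwining (g^~ x) (h^~ x) z.
pose c x := cl_coord (T x * S x) finset.set0.
have T_C : cl_class_C k Omega T by exact: cl_class_C_intertwining.
have S_C : cl_class_C k Omega S by exact: cl_class_C_intertwining.
have c_C : scalar_class_C k Omega c by exact: (cl_class_C_mul Omega_open T_C S_C).
have c_x0 : c x0 != 0.
  by rewrite /c TS0 cl_coordZ cl_coord_basis eqxx mulr1.
(* The radius is small enough for c to stay nonzero on the ball. *)
have [eps [eps_gt0 eps_ball]] : exists e, 0 < e /\
    euclidean_ball x0 e `<=` [set x | Omega x /\ c x != 0].
  apply: euclidean_ball_nbhs; apply: filterI.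
    by apply: open_nbhs_nbhs; split.
  exact: scalar_neq0_nbhs c_C x0_Omega c_x0.
have ballO : euclidean_ball x0 eps `<=` Omega by move=> x /eps_ball[].
have c0 x : euclidean_ball x0 eps x -> c x != 0 by move=> /eps_ball[].
set B := euclidean_ball x0 eps in eps_ball ballO c0 *.
have B_open : open B by exact: euclidean_ball_open.
exists eps; split=> //.
have hT x a : B x -> h a x * T x = T x * g a x.
  by move=> /ballO Ox; apply: intertwining_gen => //; [exact: hP|exact: gP].
have gS x a : B x -> g a x * S x = S x * h a x.
  by move=> /ballO Ox; apply: intertwining_gen => //; [exact: gP|exact: hP].
have TS x : B x -> T x * S x = c x *: 1.
  move=> Bx; apply: family_commutant (hP _ (ballO _ Bx)) _ => // a.
  by rewrite mulrA hT // -!mulrA gS.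
have TU x : B x -> T x \is a GRing.unit /\ S x * T x = c x *: 1.
  move=> Bx; apply: intertwiner_unit (gP _ (ballO _ Bx)) _ _ (c0 x Bx) (TS x Bx).
  - by [].
  - by [].
  - by move=> a; exact: hT.
  - by move=> a; exact: gS.
have T_CB := cl_class_C_sub ballO T_C; have S_CB := cl_class_C_sub ballO S_C.
have c_CB : scalar_class_C k B c by exact: (cl_class_C_mul B_open T_CB S_CB).
exists T; split.
  split=> // [x /TU[]//|a x Bx]; have [Tu _] := TU x Bx.
  by rewrite -mulrA hT // mulKr.
move=> T'; split=> [[T'_C T'u T'g]|[lambda [lambda_C lambda0 T'E]]].
  pose d x := cl_coord (T' x * S x) finset.set0.
  (* Invertibility of T' turns the conjugation formula into the linear relation that S can be
     multiplied with. *)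
  have hT' x a : B x -> h a x * T' x = T' x * g a x.
    by move=> Bx; rewrite T'g // -mulrA mulVKr ?T'u.
  have T'S x : B x -> T' x * S x = d x *: 1.
    move=> Bx; apply: family_commutant (hP _ (ballO _ Bx)) _ => // a.
    by rewrite mulrA hT' // -!mulrA gS.
  have T'E x : B x -> T' x = (d x * (c x)^-1) *: T x.
    move=> Bx; have [_ ST] := TU x Bx.
    (* Bracketing T' S T in both ways gives d T = c T', which yields the factor d / c. *)
    have : T' x * (S x * T x) = d x *: T x by rewrite mulrA T'S // -scalerAl mul1r.
    rewrite ST -scalerAr mulr1 mulrC -scalerA => <-.
    by rewrite scalerA mulVf ?c0 // scale1r.
  exists (fun x => d x * (c x)^-1); split=> // [|x Bx].
    apply: scalar_class_C_mul => //; last exact: scalar_class_C_inv.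
    exact: (cl_class_C_mul B_open T'_C S_CB).
  (* A zero of the factor would make T' x zero, hence not invertible. *)
  apply: contraTneq (T'u x Bx) => dc0; by rewrite T'E // dc0 scale0r unitr0.
split=> [|x Bx|a x Bx].
- apply: cl_class_C_ext (cl_class_C_scale B_open lambda_C T_CB) => // x Bx.
  by rewrite T'E.
- have [Tu _] := TU x Bx; rewrite T'E // scaler_unit // unitfE; exact: lambda0.
have [Tu _] := TU x Bx.
have lu : lambda x \is a GRing.unit by rewrite unitfE lambda0.
rewrite T'E // invrZ // -scalerAr -!scalerAl scalerA mulfV ?lambda0 // scale1r.
by rewrite -mulrA hT // mulKr.
Qed.
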